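(* Let $m,n,r$ be positive integers, let $\mathcal{B},\delta\mathcal{B}\in\mathbb{R}^{m\times n\times r}$, $\mathcal{U}\in\mathbb{R}^{m\times m\times r}$, $\mathcal{V}\in\mathbb{R}^{n\times n\times r}$, and suppose $\mathcal{B}'=\mathcal{B}+\delta\mathcal{B}=\mathcal{U}*\mathcal{B}*\mathcal{V}\in\mathbb{R}^{m\times n\times r}$. Then, for $i=1,\dots,\min\{m,n\}$, $$\sigma_i(\mathcal{B}')\le r^2\,\sigma_i(\mathcal{B})\,\sigma_{\max}(\mathcal{U})\,\sigma_{\max}(\mathcal{V}),$$ where $\sigma_i(\cdot)$ denotes the $i$-th largest (tensor) singular value and $\sigma_{\max}=\sigma_1$.
   Context: For a third-order tensor $\mathcal{A}\in\mathbb{R}^{m\times n\times r}$, let $A_k=\mathcal{A}(:,:,k)\in\mathbb{R}^{m\times n}$, $k=1,\dots,r$, be its frontal slices. T-product: for $\mathcal{A}\in\mathbb{R}^{m\times n\times r}$ and $\mathcal{B}\in\mathbb{R}^{n\times t\times r}$, $\mathcal{A}*\mathcal{B}\in\mathbb{R}^{m\times t\times r}$ is the tensor whose frontal slices, stacked vertically, form the product of the block-circulant matrix with first block column $(A_1;A_2;\dots;A_r)$ and the stacked matrix $(B_1;B_2;\dots;B_r)$; that is, $(\mathcal{A}*\mathcal{B})_k=\sum_{j=1}^{r}A_{((k-j)\bmod r)+1}B_j$. Discrete Fourier transform along the third mode: $\hat A_k=\sum_{j=1}^{r}\omega^{(k-1)(j-1)}A_j$ with $\omega=e^{-2\pi \mathtt{i}/r}$,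 $k=1,\dots,r$. Tensor singular values: $\mathcal{A}$ has a T-SVD $\mathcal{A}=\mathcal{U}_0*\mathcal{S}*\mathcal{V}_0^{\mathrm T}$ (with $\mathcal{U}_0,\mathcal{V}_0$ orthogonal tensors and $\mathcal{S}$ having diagonal frontal slices) in which the diagonal of the $k$-th Fourier-transformed frontal slice $\hat{S}_k$ of $\mathcal{S}$ consists of the singular values of the matrix $\hat A_k$ in decreasing order. The singular values of $\mathcal{A}$ are the diagonal entries of the first frontal slice $\mathcal{S}(:,:,1)$. Equivalently, if $\sigma_1(\hat A_k)\ge\cdots\ge\sigma_{\min\{m,n\}}(\hat A_k)\ge 0$ are the ordinary singular values of $\hat A_k$, the $i$-th singular value of $\mathcal{A}$ is $$\sigma_i(\mathcal{A})=\frac1r\sum_{k=1}^{r}\sigma_i(\hat A_k),\qquad i=1,\dots,\min\{m,n\}.$$ *)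

(* Defs.v *)
From HB Require Import structures.
From mathcomp Require Import all_boot all_order all_algebra.
From mathcomp Require Import ring lra complex.
From mathcomp Require Import all_reals all_analysis.

Set Implicit Arguments.
Unset Strict Implicit.
Unset Printing Implicit Defensive.

Import Order.TTheory GRing.Theory Num.Theory.

Local Open Scope sesquilinear_scope.
Local Open Scope complex_scope.
Local Open Scope ring_scope.

(* Third-order tensors are given by their frontal slices.  All indices start
   at 0, so [A k] is the slice A_(k+1) in 1-based notation. *)
Notation tensor T m n r := {ffun 'I_r -> 'M[T]_(m, n)}.

(* The residue (k - j) mod r. *)
Definition ord_sub_mod (r : nat) (k j : 'I_r) : 'I_r :=
  Ordinal (ltn_pmod (k + (r - j)) (leq_ltn_trans (leq0n k) (ltn_ord k))).

Definition tprod (T : pzRingType) (m n t r : nat)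
    (A : tensor T m n r) (B : tensor T n t r) : tensor T m t r :=
  [ffun k => \sum_(j < r) A (ord_sub_mod k j) *m B j].

Definition dft_root (R : realType) (r : nat) : R[i] :=
  cos (2 * pi / r%:R) -i* sin (2 * pi / r%:R).

Definition tdft (R : realType) (m n r : nat) (A : tensor R m n r) :
    tensor R[i] m n r :=
  [ffun k : 'I_r =>
     \sum_(j < r) dft_root R r ^+ (k * j) *: map_mx (fun x : R => x%:C) (A j)].

(* The square roots of the eigenvalues (with multiplicity) of the Hermitian
   matrix A^* A, in decreasing order.  There are n of them; the singular values
   of A are the first min(m, n), the remaining ones being zero. *)
Definition singular_values (R : realType) (m n : nat) (A : 'M[R[i]]_(m, n)) :
    seq R :=
  sort >=%R
    [seq Num.sqrt (complex.Re (spectral_diag (A ^t* *m A) 0 j)) | j : 'I_n].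

Definition sigma (R : realType) (m n : nat) (A : 'M[R[i]]_(m, n)) (i : nat) : R :=
  nth 0 (singular_values A) i.

Definition tsigma (R : realType) (m n r : nat) (A : tensor R m n r) (i : nat) : R :=
  r%:R^-1 * \sum_(k < r) sigma (tdft A k) i.

Definition tsigma_max (R : realType) (m n r : nat) (A : tensor R m n r) : R :=
  tsigma A 0.

Lemma gram_hermsymmx (R : realType) (m n : nat) (A : 'M[R[i]]_(m, n)) :
  A ^t* *m A \is hermsymmx.
Proof.
apply/is_hermitianmxP; rewrite expr0 scale1r.
by rewrite trmx_mul map_mxM trmxCK.
Qed.

(* The squares of the singular values are the roots, with multiplicity, of the
   characteristic polynomial of A^* A. *)
Lemma char_poly_singular_values (R : realType) (m n : nat) (A : 'M[R[i]]_(m, n)) :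
  char_poly (A ^t* *m A) =
  \prod_(s <- singular_values A) ('X - ((s ^+ 2)%:C)%:P).
Proof.
set H := A ^t* *m A.
have Hn : H \is normalmx by exact/hermitian_normalmx/gram_hermsymmx.
have /orthomx_spectralP HE := Hn.
set P := spectralmx H in HE; set d := spectral_diag H in HE.
have Pu : P \in unitmx by exact: spectral_unit.
have dge0 j : 0 <= d 0 j.
  have dE : diag_mx d = (A *m P ^t*) ^t* *m (A *m P ^t*).
    rewrite trmx_mul map_mxM trmxCK mulmxA -[_ *m A]mulmxA.
    rewrite -/H HE (invmx_unitary (spectral_unitarymx H)) -/P.
    rewrite !mulmxA; have /unitarymxP -> := spectral_unitarymx H.
    by rewrite mul1mx -mulmxA; have /unitarymxP -> := spectral_unitarymx H;
       rewrite mulmx1.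
  have -> : d 0 j = diag_mx d j j by rewrite mxE eqxx mulr1n.
  rewrite dE mxE sumr_ge0// => k _.
  by rewrite !mxE mulrC mul_conjC_ge0.
have -> : char_poly H = char_poly (diag_mx d).
  rewrite /char_poly /char_poly_mx HE !map_mxM map_invmx.
  set Q := map_mx polyC P.
  have Qu : Q \in unitmx by rewrite map_unitmx.
  have XE : 'X%:M = invmx Q *m 'X%:M *m Q.
    by rewrite mul_mx_scalar -scalemxAl mulVmx// scalemx1.
  rewrite [in LHS]XE -mulmxBl -mulmxBr !det_mulmx mulrAC -det_mulmx mulVmx//.
  by rewrite det1 mul1r.
rewrite char_poly_trig ?diag_mx_is_trig//.
rewrite (perm_big _ (permEl (perm_sort _ _))) /= big_image/=.
apply: eq_bigr => j _; congr ('X - _%:P); rewrite mxE eqxx mulr1n.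
have := dge0 j; rewrite -/d; case: (d 0 j) => a b.
rewrite lecE/= => /andP[/eqP -> a0].
by rewrite sqr_sqrtr.
Qed.

Lemma dft_rootX (R : realType) (r j : nat) :
  dft_root R r ^+ j =
  cos (j%:R * (2 * pi / r%:R)) -i* sin (j%:R * (2 * pi / r%:R)).
Proof.
rewrite /dft_root; set t := 2 * pi / r%:R.
elim: j => [|j IH]; first by rewrite expr0 mul0r cos0 sin0 oppr0.
rewrite exprSr IH -(natr1 j) (mulrDl j%:R) (mul1r t) (cosD (j%:R * t)) (sinD (j%:R * t)).
apply/eqP; rewrite eq_complex /= mulrNN mulrN mulNr opprD.
by rewrite eqxx addrC eqxx.
Qed.

Lemma dft_root_prim (R : realType) (r : nat) (r_gt0 : (0 < r)%N) :
  r.-primitive_root (dft_root R r).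
Proof.
have rR : 0 < r%:R :> R by rewrite ltr0n.
have zr1 : dft_root R r ^+ r = 1.
  rewrite dft_rootX mulrC divfK ?gt_eqF// mulr_natl cos2pi sin2pi oppr0.
  by [].
have [k /prim_order_gt0 _ _] := prim_order_exists r_gt0 zr1.
apply/andP; split => //; apply/forallP => j; apply/eqP.
rewrite unity_rootE; have [->|jr] := eqVneq j.+1 r; first by rewrite zr1 eqxx.
have {}jr : (j.+1 < r)%N by rewrite ltn_neqAle jr ltn_ord.
apply/negbTE/negP => /eqP; rewrite dft_rootX.
set y := j.+1%:R * (pi / r%:R) : R.
have -> : j.+1%:R * (2 * pi / r%:R) = y + y :> R by rewrite /y; ring.
have y0 : 0 < sin y.
  apply: sin_gt0_pi; rewrite /y mulr_gt0 ?divr_gt0 ?pi_gt0 ?ltr0n//=.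
  by rewrite mulrCA gtr_pMr ?pi_gt0// ltr_pdivrMr// mul1r ltr_nat.
move=> /(congr1 (@complex.Re R)) /=; rewrite cosD => E.
have := cos2Dsin2 y; have : 0 < sin y ^+ 2 by rewrite exprn_gt0.
rewrite !expr2; lra.
Qed.

Lemma sum_dft_root (R : realType) (r : nat) (j : 'I_r) :
  \sum_(k < r) dft_root R r ^+ (k * j) = if j == 0 :> nat then r%:R else 0.
Proof.
have r_gt0 : (0 < r)%N by exact: leq_ltn_trans (leq0n j) (ltn_ord j).
case: ifPn => [/eqP ->|j0].
  by under eq_bigr do rewrite muln0 expr0; rewrite sumr_const card_ord.
have zj1 : dft_root R r ^+ j != 1.
  by rewrite -(prim_order_dvd (dft_root_prim R r_gt0)) gtnNdvd// lt0n.
have := subrX1 (dft_root R r ^+ j) r.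
rewrite -exprM mulnC exprM (prim_expr_order (dft_root_prim R r_gt0)).
rewrite expr1n subrr => /esym/eqP; rewrite mulf_eq0 subr_eq0 (negbTE zj1)/=.
by move/eqP => E; under eq_bigr do rewrite mulnC exprM.
Qed.

(* Consistency with the definition through the T-SVD: if the diagonals of the
   Fourier slices of a real tensor S carry the singular values of those of A,
   then the diagonal of the first frontal slice of S consists of the singular
   values of the tensor A. *)
Lemma tsigma_first_slice (R : realType) (m n r : nat) (r_gt0 : (0 < r)%N)
    (A S : tensor R m n r) (i : nat) (im : (i < m)%N) (i_n : (i < n)%N) :
  (forall k, tdft S k (Ordinal im) (Ordinal i_n) = (sigma (tdft A k) i)%:C) ->
  S (Ordinal r_gt0) (Ordinal im) (Ordinal i_n) = tsigma A i.
Proof.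
move=> hS.
have key : \sum_(k < r) tdft S k =
    r%:R *: map_mx (fun x : R => x%:C) (S (Ordinal r_gt0)).
  under eq_bigr do rewrite ffunE.
  rewrite exchange_big /=.
  under eq_bigr do rewrite -scaler_suml sum_dft_root.
  rewrite (bigD1 (Ordinal r_gt0))//= big1 ?addr0// => j j0.
  by rewrite ifN ?scale0r//; apply: contraNneq j0 => j0; apply/eqP/val_inj.
have rC : r%:R != 0 :> R by rewrite pnatr_eq0 -lt0n.
have /matrixP/(_ (Ordinal im) (Ordinal i_n)) := key.
rewrite summxE; under eq_bigr do rewrite hS; rewrite !mxE.
move=> /(congr1 (@complex.Re R)).
rewrite -rmorph_sum/= -(rmorph_nat (real_complex R)) /= mul0r subr0 => E.
by rewrite /tsigma E mulKf.
Qed.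

(* Main.v *)
Require Import Defs.
From mathcomp Require Import all_boot all_order all_algebra.
From mathcomp Require Import all_reals.
From mathcomp Require Import complex all_analysis zify ring.

(** The discrete Fourier transform along the third mode turns the T-product into
    the slicewise matrix product ([tdft_tprod]), so the k-th Fourier slice of
    [B'] is the product of those of [U], [B] and [V].  For matrices,

      sigma_i (U B V) <= sigma_max U * sigma_i B * sigma_max V

    ([sigma_mulmx]) follows from the Courant-Fischer principle: sigma_i A is the
    least c >= 0 such that |A x| <= c |x| on some subspace of codimension at
    most i (0-based index).  A subspace that is good for [B] pulls back along [V] to
    one that is good for [U B V].

    It remains to average over the r slices.  The sum over k of the products
    u_k b_k v_k of nonnegative terms is at most the product of the three sums;
    each sum is r times a tensor singular value, and the left-hand side carries
    one factor 1/r, which yields the constant r^3 / r = r^2. *)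

Import Order.TTheory GRing.Theory Num.Theory.

Local Open Scope sesquilinear_scope.
Local Open Scope complex_scope.
Local Open Scope ring_scope.

(** * The Fourier transform of a T-product *)

Section DiscreteFourierTransform.
Context {R : realType} {r : nat}.

Lemma ord_sub_mod_bij (j : 'I_r) : bijective (fun l => ord_sub_mod l j).
Proof.
apply: injF_bij => l l' /(congr1 val) /= /eqP.
by rewrite eqn_modDr !modn_small // => /eqP /val_inj.
Qed.

(** Characters are additive on residues mod r, because the root of unity has
    order r: reducing l - j mod r does not change the power. *)
Lemma dft_root_ord_sub_mod (k l j : 'I_r) :
  dft_root R r ^+ (k * l) =
  dft_root R r ^+ (k * ord_sub_mod l j) * dft_root R r ^+ (k * j).
Proof.
have r_gt0 : (0 < r)%N by exact: leq_ltn_trans (leq0n j) (ltn_ord j).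
have wP := dft_root_prim R r_gt0.
rewrite -exprD -mulnDr -(prim_expr_mod wP) -(prim_expr_mod wP (k * (_ + _))) /=.
rewrite -(modnMmr k (_ + _)) modnDml -addnA subnK; last exact: ltnW.
by rewrite modnDr modnMmr.
Qed.

(** The convolution theorem. *)
Lemma tdft_tprod (m n t : nat) (A : tensor R m n r) (B : tensor R n t r)
    (k : 'I_r) :
  tdft (tprod A B) k = tdft A k *m tdft B k.
Proof.
rewrite !ffunE mulmx_sumr.
under eq_bigr do rewrite ffunE raddf_sum scaler_sumr.
rewrite exchange_big; apply: eq_bigr => j _ /=.
rewrite mulmx_suml [RHS](reindex _ (onW_bij _ (ord_sub_mod_bij j))) /=.
apply: eq_bigr => l _.
by rewrite (dft_root_ord_sub_mod k l j) map_mxM -scalemxAl -scalemxAr scalerA.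
Qed.

End DiscreteFourierTransform.

(** * The Courant-Fischer characterization of singular values *)

Section SingularValues.
Context {R : realType}.
Implicit Types m n p : nat.

(** The squared Euclidean norm takes values in [R[i]] so that it can be compared
    with Hermitian forms without taking real parts. *)
Definition sqnorm {n} (x : 'cV[R[i]]_n) : R[i] := \sum_j `|x j 0| ^+ 2.

Lemma sqnormE {n} (x : 'cV[R[i]]_n) : sqnorm x = (x ^t* *m x) 0 0.
Proof. by rewrite mxE; apply: eq_bigr => j _; rewrite !mxE mulrC normCK. Qed.

Lemma sqnorm_ge0 {n} (x : 'cV[R[i]]_n) : 0 <= sqnorm x.
Proof. by apply: sumr_ge0 => j _; rewrite exprn_ge0. Qed.

Lemma sqnorm_gt0 {n} (x : 'cV[R[i]]_n) : x != 0 -> 0 < sqnorm x.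
Proof.
move=> x0; rewrite lt_def sqnorm_ge0 andbT; apply: contraNneq x0 => /eqP.
rewrite psumr_eq0 => [/allP x0|j _]; last by rewrite exprn_ge0.
apply/eqP/colP => j; rewrite mxE; apply/eqP.
by have := x0 j (mem_index_enum j); rewrite expf_eq0 normr_eq0.
Qed.

Lemma size_singular_values {m n} (A : 'M[R[i]]_(m, n)) :
  size (singular_values A) = n.
Proof. by rewrite size_sort size_image card_ord. Qed.

Lemma sigma_ge0 {m n} (A : 'M[R[i]]_(m, n)) k : 0 <= sigma A k.
Proof.
have [kn|kn] := ltnP k n; last first.
  by rewrite /sigma nth_default ?size_singular_values.
have : sigma A k \in singular_values A by rewrite mem_nth ?size_singular_values.
by rewrite mem_sort => /imageP[j _ ->]; rewrite sqrtr_ge0.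
Qed.

Lemma sigma_nonincreasing {m n} (A : 'M[R[i]]_(m, n)) j k :
  (j <= k)%N -> sigma A k <= sigma A j.
Proof.
move=> jk; have [kn|kn] := ltnP k n; last first.
  by rewrite {1}/sigma nth_default ?size_singular_values // sigma_ge0.
have ge_tot : total (>=%R : rel R) by move=> x y; exact: le_total.
have ge_trans : transitive (>=%R : rel R)
  by move=> y x z xy yz; exact: le_trans yz xy.
apply: (sorted_leq_nth ge_trans (@lexx _ _) 0 (sort_sorted ge_tot _)) => //.
- by rewrite inE size_singular_values (leq_ltn_trans jk).
- by rewrite inE size_singular_values.
Qed.

(** The right half of a singular value decomposition: [Q] is unitary and the
    conjugate transposes of its rows are eigenvectors of [A^* A], ordered by
    decreasing singular value.  It is the unitary matrix of the spectral theorem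
    with its rows permuted by the permutation that sorts the singular values. *)
Lemma singular_basis {m n} (A : 'M[R[i]]_(m, n)) :
  exists Q : 'M[R[i]]_n, forall x : 'cV_n,
    sqnorm (Q *m x) = sqnorm x /\
    sqnorm (A *m x) = \sum_(k < n) ((sigma A k) ^+ 2)%:C * `|(Q *m x) k 0| ^+ 2.
Proof.
set H := A ^t* *m A.
have Hn : H \is normalmx by exact/hermitian_normalmx/gram_hermsymmx.
have /orthomx_spectralP HE := Hn.
set P := spectralmx H in HE; set d := spectral_diag H in HE.
have PP : P *m P ^t* = 1%:M by apply/unitarymxP/spectral_unitarymx.
have PP' : P ^t* *m P = 1%:M by apply: mulmx1C.
rewrite (invmx_unitary (spectral_unitarymx H)) -/P in HE.
have Pnorm x : sqnorm (P *m x) = sqnorm x.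
  by rewrite !sqnormE trmx_mul map_mxM -mulmxA [P ^t* *m _]mulmxA PP' mul1mx.
have Anorm x : sqnorm (A *m x) = \sum_j d 0 j * `|(P *m x) j 0| ^+ 2.
  rewrite sqnormE trmx_mul map_mxM -mulmxA [A ^t* *m _]mulmxA -/H HE.
  rewrite -!mulmxA mulmxA -map_mxM -trmx_mul mxE; apply: eq_bigr => j _.
  by rewrite mul_diag_mx !mxE mulrCA normCK [_^* * _]mulrC.
(* The value of the form at the j-th eigenvector is the j-th eigenvalue. *)
have dge0 j : 0 <= d 0 j.
  have := sqnorm_ge0 (A *m (P ^t* *m delta_mx j 0)).
  rewrite Anorm mulmxA PP mul1mx (bigD1 j) //= big1 => [|l /negbTE lj].
    by rewrite mxE !eqxx normr1 expr1n mulr1 addr0.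
  by rewrite mxE lj normr0 expr0n mulr0.
pose s j := Num.sqrt (complex.Re (d 0 j)).
have dE j : d 0 j = (s j ^+ 2)%:C.
  have := dge0 j; rewrite /s; case: (d 0 j) => a b.
  by rewrite lecE /= => /andP[/eqP -> a0]; rewrite sqr_sqrtr.
pose e := sort_tuple (relpre s >=%R) (ord_tuple n).
have sigmaE (k : 'I_n) : sigma A k = s (tnth e k).
  rewrite /sigma /singular_values -/H -/d sort_map.
  by rewrite -val_ord_tuple -(tnth_map s e) (tnth_nth 0).
have sum_e (F : 'I_n -> R[i]) : \sum_k F (tnth e k) = \sum_j F j.
  rewrite -(big_tuple _ _ e xpredT) (perm_big _ (permEl (perm_sort _ _))) /=.
  by rewrite big_enum.
exists (rowsub (tnth e) P) => x; rewrite mul_rowsub_mx -[in RHS]Pnorm Anorm.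
split.
  by rewrite -[RHS]sum_e; apply: eq_bigr => k _; rewrite mxE.
by rewrite -[LHS]sum_e; apply: eq_bigr => k _; rewrite dE sigmaE [in RHS]mxE.
Qed.

(** Courant-Fischer, attained bound.  A subspace of codimension at most k is
    given as the kernel of a matrix with k rows, a form stable under pullback
    (replace [C] by [C *m V]).  Here it is the orthogonal complement of the k
    leading right singular vectors. *)
Lemma sigma_subspace {m n} (A : 'M[R[i]]_(m, n)) k :
  exists C : 'M[R[i]]_(k, n), forall x : 'cV_n,
    C *m x = 0 -> sqnorm (A *m x) <= ((sigma A k) ^+ 2)%:C * sqnorm x.
Proof.
have [Q QP] := singular_basis A.
(* The first k rows of [Q], padded with zeros when k exceeds n. *)
exists (\matrix_(a, j) (if insub (val a) is Some l then Q l j else 0)) => x Cx.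
have [<- ->] := QP x; rewrite mulr_sumr; apply: ler_sum => l _.
have [kl|lk] := leqP k l.
  rewrite ler_wpM2r ?exprn_ge0 // lecR.
  by rewrite lerXn2r ?nnegrE ?sigma_ge0 ?sigma_nonincreasing.
suff -> : (Q *m x) l 0 = 0 by rewrite normr0 expr0n !mulr0.
have /colP/(_ (Ordinal lk)) := Cx; rewrite !mxE => CxE.
by rewrite -[RHS]CxE; apply: eq_bigr => j _; rewrite !mxE /= valK.
Qed.

Lemma sigma0_bound {m n} (A : 'M[R[i]]_(m, n)) (x : 'cV_n) :
  sqnorm (A *m x) <= ((sigma A 0) ^+ 2)%:C * sqnorm x.
Proof. by have [C] := sigma_subspace A 0; apply; exact: flatmx0. Qed.

Lemma exists_kernel_vector {F : fieldType} {m n} (C : 'M[F]_(m, n)) :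
  (m < n)%N -> exists2 x : 'cV[F]_n, x != 0 & C *m x = 0.
Proof.
move=> mn; have : kermx C^T != 0.
  rewrite -mxrank_eq0 mxrank_ker -lt0n subn_gt0.
  exact: leq_ltn_trans (rank_leq_col _) mn.
case/rowV0Pn=> v /sub_kermxP vC v0; exists v^T; first by rewrite trmx_eq0.
by rewrite -[C]trmxK -trmx_mul vC trmx0.
Qed.

(** Courant-Fischer, optimality.  For k < n the kernel of [C] has dimension at
    least n - k, so it meets the span of the k + 1 leading right singular vectors
    in a nonzero vector [x], where |A x| >= sigma_k |x|. *)
Lemma sigma_le_subspace {m n} (A : 'M[R[i]]_(m, n)) k
    (C : 'M[R[i]]_(k, n)) (c : R) :
  0 <= c ->
  (forall x : 'cV_n, C *m x = 0 -> sqnorm (A *m x) <= (c ^+ 2)%:C * sqnorm x) ->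
  sigma A k <= c.
Proof.
move=> c0 AC; have [kn|kn] := ltnP k n; last first.
  by rewrite /sigma nth_default ?size_singular_values.
have [Q QP] := singular_basis A.
(* The kernel of [D] is the span of the k + 1 leading singular vectors. *)
pose D : 'M[R[i]]_(n - k.+1, n) :=
  \matrix_(a, j) (if insub (k.+1 + a)%N is Some l then Q l j else 0).
(* Together, [C] and [D] impose k + (n - k - 1) = n - 1 conditions. *)
have [|x x0] := exists_kernel_vector (col_mx C D); first lia.
rewrite mul_col_mx => /eqP; rewrite col_mx_eq0 => /andP[/eqP Cx /eqP Dx].
have Qx0 (l : 'I_n) : (k < l)%N -> (Q *m x) l 0 = 0.
  move=> kl; have al : (l - k.+1 < n - k.+1)%N by have := ltn_ord l; lia.
  have /colP/(_ (Ordinal al)) := Dx; rewrite !mxE => DxE.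
  by rewrite -[RHS]DxE; apply: eq_bigr => j _; rewrite !mxE /= subnKC // valK.
have : ((sigma A k) ^+ 2)%:C * sqnorm x <= (c ^+ 2)%:C * sqnorm x.
  apply: le_trans (AC x Cx); have [<- ->] := QP x.
  rewrite mulr_sumr; apply: ler_sum => l _.
  have [lk|kl] := leqP l k; last by rewrite Qx0 // normr0 expr0n !mulr0.
  rewrite ler_wpM2r ?exprn_ge0 // lecR.
  by rewrite lerXn2r ?nnegrE ?sigma_ge0 ?sigma_nonincreasing.
by rewrite ler_pM2r ?sqnorm_gt0 // lecR ler_pXn2r ?nnegrE ?sigma_ge0.
Qed.

(** If |B y| <= sigma_k B |y| for all y in the kernel of [C], then for x in the
    kernel of [C *m V] the operator norm bounds for [U] and [V] give
    |U B V x| <= sigma_0 U * sigma_k B * sigma_0 V * |x|. *)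
Lemma sigma_mulmx {m n p q} (U : 'M[R[i]]_(m, n)) (B : 'M[R[i]]_(n, p))
    (V : 'M[R[i]]_(p, q)) k :
  sigma (U *m B *m V) k <= sigma U 0 * sigma B k * sigma V 0.
Proof.
have [C CP] := sigma_subspace B k.
apply: (sigma_le_subspace _ _ (C *m V)); first by rewrite !mulr_ge0 ?sigma_ge0.
move=> x; rewrite -!mulmxA => CVx.
have sqM (a b c : R) :
    ((a * b * c) ^+ 2)%:C = (a ^+ 2)%:C * ((b ^+ 2)%:C * (c ^+ 2)%:C).
  by rewrite !exprMn -mulrA -!rmorphM.
rewrite sqM -!mulrA.
have sq0 (a : R) : 0 <= (a ^+ 2)%:C by rewrite lecR sqr_ge0.
apply: le_trans (sigma0_bound _ _) _; rewrite ler_wpM2l //.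
apply: le_trans (CP _ CVx) _; rewrite ler_wpM2l //.
exact: sigma0_bound.
Qed.

End SingularValues.

(** * Averaging over the Fourier slices *)

Lemma sum_mul3_le {R : numDomainType} {I : finType} (a b c : I -> R) :
  (forall k, 0 <= a k) -> (forall k, 0 <= b k) -> (forall k, 0 <= c k) ->
  \sum_k a k * b k * c k <= (\sum_k a k) * (\sum_k b k) * (\sum_k c k).
Proof.
have term_le (f : I -> R) k : (forall j, 0 <= f j) -> f k <= \sum_j f j.
  by move=> f0; rewrite (bigD1 k) //= lerDl sumr_ge0.
move=> a0 b0 c0; rewrite -mulrA mulr_suml; apply: ler_sum => k _.
by rewrite -mulrA ler_wpM2l ?ler_pM ?term_le.
Qed.

Theorem theorem5p3 (R : realType) (m n r : nat)
  (hm : (0 < m)%N) (hn : (0 < n)%N) (hr : (0 < r)%N)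
  (B dB B' : tensor R m n r) (U : tensor R m m r) (V : tensor R n n r)
  (hB' : B' = B + dB) (hUBV : B' = tprod (tprod U B) V)
  (i : nat) (hi : (i < minn m n)%N) :
  tsigma B' i <= r%:R ^+ 2 * tsigma B i * tsigma_max U * tsigma_max V.
Proof.
have r0 : r%:R != 0 :> R by rewrite pnatr_eq0 -lt0n.
rewrite hUBV /tsigma_max /tsigma.
set SU := \sum_k sigma (tdft U k) 0; set SB := \sum_k sigma (tdft B k) i.
set SV := \sum_k sigma (tdft V k) 0.
have -> : r%:R ^+ 2 * (r%:R^-1 * SB) * (r%:R^-1 * SU) * (r%:R^-1 * SV) =
    r%:R^-1 * (SU * SB * SV) by field.
rewrite ler_wpM2l ?invr_ge0 ?ler0n //.
apply: le_trans (sum_mul3_le _ _ _ _ _ _) => [|k|k|k]; rewrite ?sigma_ge0 //.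
by apply: ler_sum => k _; rewrite !tdft_tprod sigma_mulmx.
Qed.
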